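(* Let $\mathcal{V}$ be a Hilbert space, $\mathcal{V}_h \subset \mathcal{V}$ a finite dimensional (finite element) subspace, $B(\cdot,\cdot):\mathcal{V}\times\mathcal{V}\to\mathbb{R}$ a bilinear form, $L:\mathcal{V}\to\mathbb{R}$ a linear functional, and $J:\mathcal{V}\to\mathbb{R}$ a nonlinear functional. Let $u\in\mathcal{V}$, $u_h\in\mathcal{V}_h$ and $z\in\mathcal{V}$ solve, respectively, $$B(u,\varphi)=L(\varphi)\quad\forall\varphi\in\mathcal{V},$$ $$B(u_h,\varphi_h)=L(\varphi_h)\quad\forall\varphi_h\in\mathcal{V}_h,$$ $$B(\varphi,z)=J'(u_h;\varphi)\quad\forall\varphi\in\mathcal{V}.$$ Let $e:=u-u_h$, and let $J$ be chosen so that $J'(u_h;e)=B(e,\psi_h)$ for some $\psi_h\in\mathcal{V}_h$. Then the estimate $\eta_2\approx J(u)-J(u_h)$ given by $$\eta_2:=L(z)-B(u_h,z)$$ is not reliable.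
   Context: Derivatives: $J'(u;v):=\lim_{\varepsilon\to0}\varepsilon^{-1}[J(u+\varepsilon v)-J(u)]$ and $J''(u;v,w):=\lim_{\varepsilon\to0}\varepsilon^{-1}[J'(u+\varepsilon w;v)-J'(u;v)]$. Standing assumptions: $J$ has sufficient regularity such that its first and second Fréchet derivatives exist (these agree with $J'$ and $J''$), and the problem of finding $u\in\mathcal{V}$ with $B(u,\varphi)=L(\varphi)$ for all $\varphi\in\mathcal{V}$ is well-posed. Definition (reliable): an error estimate $\eta\approx J(u)-J(u_h)$ is said to be reliable if there exists a constant $C\in\mathbb{R}_{>0}$ independent of $u_h$ such that $|J(u)-J(u_h)|\le C|\eta|$.
   Formalization: The claim fails when J(u)=J(u_h) (e.g. u=u_h), so non-reliability is stated assuming J(u)≠J(u_h) for some discretisation considered; it is added that whenever e≠0 a nonlinear J satisfying the condition exists for which η_2 is not reliable. *)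

(* Defs.v *)
From HB Require Import structures.
From mathcomp Require Import all_boot all_order all_algebra.
From mathcomp Require Import all_classical all_reals all_analysis.
Import Order.TTheory GRing.Theory Num.Theory.
Import numFieldNormedType.Exports.

Set Implicit Arguments.
Unset Strict Implicit.
Unset Printing Implicit Defensive.

Local Open Scope classical_set_scope.
Local Open Scope ring_scope.

(* A Hilbert space is a complete normed space whose norm is induced by an inner
   product; completeness is carried by the type of [V]. *)
Definition induces_norm (R : realType) (V : completeNormedModType R)
    (ip : {dot V for idfun}) : Prop :=
  forall x, `|x| ^+ 2 = ip x x.

(* The linear span of a finite family; {vspace} is unavailable because [V] may
   be infinite-dimensional. *)
Definition finite_dim_subspace (R : realType) (V : completeNormedModType R)
    (W : set V) : Prop :=
  exists (n : nat) (b : 'I_n -> V),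
    W = [set v | exists c : 'I_n -> R, v = \sum_(i < n) c i *: b i].

Definition solves_primal (R : realType) (V : completeNormedModType R)
    (B : {biscalar V}) (L : {scalar V}) (u : V) : Prop :=
  forall phi, B u phi = L phi.

Definition solves_discrete (R : realType) (V : completeNormedModType R)
    (W : set V) (B : {biscalar V}) (L : {scalar V}) (uh : V) : Prop :=
  W uh /\ forall phi, W phi -> B uh phi = L phi.

(* ['D_phi J uh] is the limit of [eps^-1 (J (uh + eps phi) - J uh)] as eps tends
   to 0, i.e. J'(uh; phi). *)
Definition solves_dual (R : realType) (V : completeNormedModType R)
    (B : {biscalar V}) (J : V -> R) (uh z : V) : Prop :=
  forall phi, B phi z = 'D_phi J uh.

(* Hadamard well-posedness: existence and uniqueness of the solution for the
   datum [L] (take [L' = L], [M = 0]) and for every perturbed datum [L'] with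
   [L' - L] of dual norm at most [M], with Lipschitz dependence on the datum.
   Neither [B] nor [L] is required to be bounded. *)
Definition well_posed (R : realType) (V : completeNormedModType R)
    (B : {biscalar V}) (L : {scalar V}) : Prop :=
  exists (c : R) (u : V),
    solves_primal B L u /\
    forall (L' : {scalar V}) (M : R), 0 <= M ->
      (forall phi, `|L' phi - L phi| <= M * `|phi|) ->
      exists u' : V,
        [/\ solves_primal B L' u',
            forall w, solves_primal B L' w -> w = u'
          & `|u' - u| <= c * M].

(* [J] is Frechet differentiable everywhere, and so is [x |-> 'd J x] as a map
   into the dual space: the bounded bilinear form [H] is the second derivative
   at [x], the remainder being measured in the dual norm. *)
Definition twice_Frechet (R : realType) (V : completeNormedModType R)
    (J : V -> R) : Prop :=
  (forall x, differentiable J x) /\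
  forall x, exists H : {biscalar V},
    (exists K : R, forall v w, `|H v w| <= K * `|v| * `|w|) /\
    forall eps : R, 0 < eps ->
      \forall w \near (0 : V), forall v,
        `|'d J (x + w) v - 'd J x v - H v w| <= eps * `|w| * `|v|.

Definition eta2 (R : realType) (V : completeNormedModType R)
    (B : {biscalar V}) (L : {scalar V}) (uh z : V) : R :=
  L z - B uh z.

(* [I] indexes the discretisations (V_h, u_h); that the constant is uniform in
   [i] expresses its independence of u_h. *)
Definition reliable (R : realType) (I : Type) (err eta : I -> R) : Prop :=
  exists C : R, 0 < C /\ forall i, `|err i| <= C * `|eta i|.

(* Main.v *)
Require Import Defs.
From HB Require Import structures.
From mathcomp Require Import all_boot all_order all_algebra.
From mathcomp Require Import all_classical all_reals all_analysis.
Import Order.TTheory GRing.Theory Num.Theory.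
Import numFieldNormedType.Exports.
Local Open Scope classical_set_scope.
Local Open Scope ring_scope.

From mathcomp Require Import ring.

Set Implicit Arguments.
Unset Strict Implicit.
Unset Printing Implicit Defensive.

(** Write e = u - uh.  Since B(u, .) = L on the whole space,
    eta2 = L z - B(uh, z) = B(e, z), and the dual equation turns this into
    J'(uh; e).  If J'(uh; e) = B(e, psi) with psi in V_h, Galerkin orthogonality
    (the two equations agree on V_h) makes it vanish: eta2 = 0 whatever the
    goal error is, so no constant C can bound a nonzero goal error by
    C |eta2|.

    For the existence of such a functional, take the squared distance
    J v = |v - uh|^2.  It is quadratic, with J'(x; v) = 2 <x - uh, v> and
    J''(x; v, w) = 2 <v, w>, hence twice Frechet differentiable by the
    Cauchy-Schwarz inequality.  At uh its derivative is zero, so z = 0 and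
    psi = 0 are admissible, whereas J u - J uh = |e|^2 > 0. *)

Section InnerProduct.
Context (R : realType) (V : completeNormedModType R) (ip : {dot V for idfun}).
Hypothesis hV : induces_norm ip.

Lemma ipC x y : ip x y = ip y x.
Proof. by rewrite hermitian_subproof expr0 mul1r. Qed.

Lemma ipDl x y z : ip (x + y) z = ip x z + ip y z.
Proof. exact: linearDl. Qed.

Lemma ipZl a x y : ip (a *: x) y = a * ip x y.
Proof. exact: linearZl_LR. Qed.

Lemma ipDr x y z : ip z (x + y) = ip z x + ip z y.
Proof. by rewrite ipC ipDl !(ipC z). Qed.

Lemma ipZr a x y : ip y (a *: x) = a * ip y x.
Proof. by rewrite ipC ipZl (ipC y). Qed.

Lemma sqr_normD x y : `|x + y| ^+ 2 = `|x| ^+ 2 + 2 * ip x y + `|y| ^+ 2.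
Proof. by rewrite !hV ipDl !ipDr (ipC y x) mulr_natl mulr2n !addrA. Qed.

Lemma ip_CauchySchwarz x y : `|ip x y| <= `|x| * `|y|.
Proof.
have [->|y0] := eqVneq y 0.
  by rewrite normr0 mulr0 linear0r normr0.
have y2 : 0 < `|y| ^+ 2 by rewrite exprn_gt0 ?normr_gt0.
(* Expand |t x - s y|^2 >= 0 at t = |y|^2 and s = <x, y>. *)
have := sqr_ge0 `|(`|y| ^+ 2) *: x + (- ip x y) *: y|.
rewrite sqr_normD ipZl ipZr !normrZ !exprMn normrN !real_normK ?num_real//.
have -> : `|y| ^+ 2 ^+ 2 * `|x| ^+ 2
    + 2 * (`|y| ^+ 2 * (- ip x y * ip x y)) + ip x y ^+ 2 * `|y| ^+ 2
  = `|y| ^+ 2 * ((`|x| * `|y|) ^+ 2 - ip x y ^+ 2) by ring.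
rewrite pmulr_rge0// subr_ge0 => h.
by rewrite -(@ler_pXn2r _ 2) ?nnegrE ?mulr_ge0// real_normK ?num_real.
Qed.

(** Twice the inner product: the second derivative of the squared distance. *)
Definition dbl_ip (v w : V) : R := 2 * ip v w.

Lemma dbl_ip_bilinear :
  bilinear_for (GRing.Scale.Law.clone _ _ *%R _)
    (GRing.Scale.Law.clone _ _ *%R _) dbl_ip.
Proof.
by split=> [w|w] a x y /=; rewrite /dbl_ip ?ipDl ?ipDr ?ipZl ?ipZr mulrDr mulrCA.
Qed.

HB.instance Definition _ :=
  bilinear_isBilinear.Build R V V R _ _ dbl_ip dbl_ip_bilinear.

Lemma dbl_ip_linear v : linear (dbl_ip v : V -> R).
Proof. exact: dbl_ip_bilinear.2. Qed.

HB.instance Definition _ v :=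
  GRing.isLinear.Build R V R _ (dbl_ip v : V -> R) (dbl_ip_linear v).

Lemma dbl_ip_bounded v w : `|dbl_ip v w| <= 2 * `|v| * `|w|.
Proof.
by rewrite /dbl_ip normrM ger0_norm// -mulrA ler_pM2l// ip_CauchySchwarz.
Qed.

Lemma dbl_ip_continuous v : continuous (dbl_ip v : V -> R).
Proof.
apply: (@linear_bounded_continuous _ _ _ (dbl_ip v : {linear V -> R})).1.
apply/linear_boundedP; near=> r => w.
by apply: (le_trans (dbl_ip_bounded v w)); apply: ler_wpM2r.
Unshelve. all: by end_near. Qed.

(** The squared distance to [a]. *)
Definition sqdist (a v : V) : R := `|v - a| ^+ 2.

Lemma sqdist_expand a x :
  sqdist a \o shift x = cst (sqdist a x) + dbl_ip (x - a) +o_ 0 id.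
Proof.
apply/eqaddoP => e e0; near=> w.
have -> : (sqdist a \o shift x - (cst (sqdist a x) + dbl_ip (x - a))) w
    = `|w| * `|w|.
  rewrite /= /sqdist !fctE/= [w + x]addrC -addrA [w - a]addrC addrA.
  by rewrite sqr_normD /dbl_ip [X in X - _]addrC addrK expr2.
by rewrite normrM normr_id ler_wpM2r.
Unshelve. all: by end_near. Qed.

Lemma diff_sqdist a x : 'd (sqdist a) x = dbl_ip (x - a) :> (V -> R).
Proof.
apply: (@diff_unique _ _ _ _ (dbl_ip (x - a) : {linear V -> R})).
  exact: dbl_ip_continuous.
exact: sqdist_expand.
Qed.

Lemma differentiable_sqdist a x : differentiable (sqdist a) x.
Proof.
apply/diff_locallyP; rewrite diff_sqdist; split.
  exact: dbl_ip_continuous.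
exact: sqdist_expand.
Qed.

Lemma twice_Frechet_sqdist a : twice_Frechet (sqdist a).
Proof.
split=> [x|x]; first exact: differentiable_sqdist.
exists (dbl_ip : {biscalar V}); split; first by exists 2; exact: dbl_ip_bounded.
move=> eps eps0; near=> w => v.
(* The derivative is affine in the base point, so the remainder is zero. *)
have -> : 'd (sqdist a) (x + w) v - 'd (sqdist a) x v - dbl_ip v w = 0.
  by rewrite !diff_sqdist /dbl_ip (addrAC x) ipDl (ipC v); ring.
by rewrite normr0 !mulr_ge0// ltW.
Unshelve. all: by end_near. Qed.

Lemma derive_sqdist_center a v : 'D_v (sqdist a) a = 0.
Proof.
rewrite deriveE; last exact: differentiable_sqdist.
by rewrite diff_sqdist /dbl_ip subrr linear0l mulr0.
Qed.

(** Linearity would force J (a + e) + J (a - e) = J (2 a) = 2 J a = 0, but the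
    left-hand side is 2 |e|^2. *)
Lemma sqdist_not_scalar (a e : V) : e != 0 -> ~ scalar (sqdist a).
Proof.
move=> e0 hlin.
have J0 : sqdist a a = 0 by rewrite /sqdist subrr normr0 expr0n.
have Jp : sqdist a (a + e) = `|e| ^+ 2 by rewrite /sqdist addrAC subrr add0r.
have Jm : sqdist a (a - e) = `|e| ^+ 2.
  by rewrite /sqdist addrAC subrr add0r normrN.
have := hlin 1 (a + e) (a - e).
rewrite scale1r addrACA subrr addr0 -[X in X + a]scale1r hlin J0 Jp Jm.
rewrite /= !mul1r addr0 => /esym/eqP.
by rewrite -mulr2n mulrn_eq0/= expf_eq0/= normr_eq0 (negPf e0).
Qed.

End InnerProduct.

Section Estimate.
Context (R : realType) (V : completeNormedModType R).
Context (B : {biscalar V}) (L : {scalar V}).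

Lemma Galerkin_orthogonality (W : set V) (u uh phi : V) :
  solves_primal B L u -> solves_discrete W B L uh -> W phi ->
  B (u - uh) phi = 0.
Proof. by move=> hu [_ huh] Wphi; rewrite linearBl hu huh// subrr. Qed.

Lemma eta2_eq0 (W : set V) (J : V -> R) (u uh z psi : V) :
  solves_primal B L u -> solves_discrete W B L uh -> solves_dual B J uh z ->
  W psi -> 'D_(u - uh) J uh = B (u - uh) psi -> eta2 B L uh z = 0.
Proof.
move=> hu huh hz Wpsi hJ.
by rewrite /eta2 -hu -linearBl hz hJ (Galerkin_orthogonality hu huh).
Qed.

Lemma not_reliable_eta0 (I : Type) (err eta : I -> R) (i : I) :
  err i != 0 -> eta i = 0 -> ~ reliable err eta.
Proof.
move=> erri etai [C [_ /(_ i)]].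
by rewrite etai normr0 mulr0 normr_le0 (negPf erri).
Qed.

End Estimate.

Lemma finite_dim_subspace0 (R : realType) (V : completeNormedModType R)
  (W : set V) : finite_dim_subspace W -> W 0.
Proof.
move=> [n [b ->]]; exists (fun=> 0).
by rewrite big1// => i _; rewrite scale0r.
Qed.

Theorem theorem1 (R : realType) (V : completeNormedModType R)
    (ip : {dot V for idfun}) (hV : induces_norm ip)
    (B : {biscalar V}) (L : {scalar V}) (hwp : well_posed B L)
    (u : V) (hu : solves_primal B L u) :
  (* for every functional and every family of discretisations on which the
     goal error does not vanish identically, eta2 is not reliable *)
  (forall (J : V -> R) (I : Type) (Vh : I -> set V) (uh z : I -> V),
     ~ scalar J ->
     twice_Frechet J ->
     (forall i, finite_dim_subspace (Vh i)) ->
     (forall i, solves_discrete (Vh i) B L (uh i)) ->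
     (forall i, solves_dual B J (uh i) (z i)) ->
     (forall i, exists psi,
        Vh i psi /\ 'D_(u - uh i) J (uh i) = B (u - uh i) psi) ->
     (exists i, J u <> J (uh i)) ->
     ~ reliable (fun i => J u - J (uh i)) (fun i => eta2 B L (uh i) (z i)))
  /\
  (* and for every discrete solution with nonzero error such a functional J can
     be chosen *)
  (forall (Vh : set V) (uh : V),
     finite_dim_subspace Vh ->
     solves_discrete Vh B L uh ->
     u - uh <> 0 ->
     exists (J : V -> R) (z : V),
       [/\ ~ scalar J,
           twice_Frechet J,
           solves_dual B J uh z,
           exists psi, Vh psi /\ 'D_(u - uh) J uh = B (u - uh) psi
         & ~ reliable (fun _ : unit => J u - J uh)
                      (fun _ : unit => eta2 B L uh z)]).
Proof.
split=> [J I Vh uh z _ _ _ huh hz hpsi [i Ji]|Vh uh hVh huh e0].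
  have [psi [Wpsi hJ]] := hpsi i.
  apply: (@not_reliable_eta0 _ _ _ _ i); first by rewrite subr_eq0; apply/eqP.
  exact: eta2_eq0 hu (huh i) (hz i) Wpsi hJ.
have dual0 : solves_dual B (sqdist uh) uh 0.
  by move=> phi; rewrite linear0r (derive_sqdist_center hV).
have Vh0 := finite_dim_subspace0 hVh.
have hJ : 'D_(u - uh) (sqdist uh) uh = B (u - uh) 0.
  by rewrite linear0r (derive_sqdist_center hV).
exists (sqdist uh), 0; split.
- by apply: (@sqdist_not_scalar _ _ _ (u - uh)); apply/eqP.
- exact: (twice_Frechet_sqdist hV).
- exact: dual0.
- by exists 0.
- apply: (@not_reliable_eta0 _ _ _ _ tt); last first.
    exact: eta2_eq0 hu huh dual0 Vh0 hJ.
  rewrite /sqdist subrr normr0 expr0n subr0 expf_eq0/= normr_eq0.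
  exact/eqP.
Qed.
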